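(* Let $\mathbf{T}_F^C=\mathbf{I}_L\otimes\mathbf{R}$ and $\mathbf{T}_C^F=\mathbf{I}_L\otimes\mathbf{S}$ be block-wise defined restriction and interpolation operators, which treat the subintervals independently of each other. Let $\mathbf{P}_0,\ldots,\mathbf{P}_{L-1}$ and $\tilde{\mathbf{P}}_0,\ldots,\tilde{\mathbf{P}}_{L-1}$ be the (invertible) fine and coarse preconditioners describing SDC sweeps on the subintervals $[t_l,t_{l+1}]$, $l=0,\ldots,L-1$. Let $\mathbf{M}_{[t_0,T]}$ be the composite collocation matrix, let $\mathbf{N},\tilde{\mathbf{N}}$ be the fine and coarse operators computing the initial value for the following subinterval, and assume $$\tilde{\mathbf{N}}\,\mathbf{R}=\mathbf{R}\,\mathbf{N}.$$ Let $\mathbf{c}_{[t_0,T]}=(\mathbf{U}_0,0,\ldots,0)^T$ and $\tilde{\mathbf{c}}_{[t_0,T]}=\mathbf{T}_F^C\mathbf{c}_{[t_0,T]}$. Then the linear two-level version of PFASST (defined in the context) can be written in matrix form as $$\mathbf{U}^{k+\frac12}_{[t_0,T]}=\mathbf{U}^{k}_{[t_0,T]}+\mathbf{T}_C^F\,\tilde{\mathbf{P}}_{[t_0,T]}^{-1}\,\mathbf{T}_F^C\left(\mathbf{c}_{[t_0,T]}-\mathbf{M}_{[t_0,T]}\mathbf{U}^{k}_{[t_0,T]}\right),$$ $$\mathbf{U}^{k+1}_{[t_0,T]}=\mathbf{U}^{k+\frac12}_{[t_0,T]}+\hat{\mathbf{P}}_{[t_0,T]}^{-1}\left(\mathbf{c}_{[t_0,T]}-\mathbf{M}_{[t_0,T]}\mathbf{U}^{k+\frac12}_{[t_0,T]}\right),$$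 and its iteration matrix (the linear part of the affine map $\mathbf{U}^k_{[t_0,T]}\mapsto\mathbf{U}^{k+1}_{[t_0,T]}$) is $$\mathbf{T}_{\mathrm{PFASST}}=\left(\mathbf{I}-\hat{\mathbf{P}}_{[t_0,T]}^{-1}\mathbf{M}_{[t_0,T]}\right)\left(\mathbf{I}-\mathbf{T}_C^F\,\tilde{\mathbf{P}}_{[t_0,T]}^{-1}\,\mathbf{T}_F^C\,\mathbf{M}_{[t_0,T]}\right).$$
   Context: Setting. The linear ODE $U(t)=U(t_0)+\int_{t_0}^tAU(s)\,ds$ on $[t_0,T]$, $A\in\mathbb{R}^{N\times N}$, is discretized on subintervals $[t_l,t_{l+1}]$, $l=0,\ldots,L-1$, $t_L=T$, of length $\Delta t$, each with $M$ quadrature nodes $\tau_1<\cdots<\tau_M=t_{l+1}$. The collocation matrix on one subinterval is $\mathbf{M}_l=\mathbf{I}-\Delta t\,\mathbf{Q}\otimes A\in\mathbb{R}^{NM\times NM}$, where $\mathbf{Q}\in\mathbb{R}^{M\times M}$ is the quadrature matrix with $\Delta t\,\mathbf{Q}_{ij}=\int_{t_l}^{\tau_i}\ell_j(s)\,ds$ and $\ell_j$ are the Lagrange polynomials of the nodes. The SDC preconditioner is $\mathbf{P}_l=\mathbf{I}-\Delta t\,\mathbf{Q}_\Delta\otimes A$ with $\mathbf{Q}_\Delta$ a lower triangular approximation of $\mathbf{Q}$; one SDC sweep with right-hand side $\mathbf{c}$ is $\mathbf{U}\mapsto\mathbf{U}+\mathbf{P}_l^{-1}(\mathbf{c}-\mathbf{M}_l\mathbf{U})$.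 Let $\mathbf{U}_0=\mathbf{1}_M\otimes U(t_0)\in\mathbb{R}^{NM}$ and $\mathbf{N}=\mathbf{N}_M\otimes\mathbf{I}_N\in\mathbb{R}^{NM\times NM}$, where $\mathbf{N}_M\in\mathbb{R}^{M\times M}$ has ones in its last column and zeros elsewhere (so $\mathbf{N}$ copies the value at the last node to all nodes). Quantities on a coarse level with $\tilde N$ spatial unknowns and $\tilde M$ nodes are defined in the same way and carry a tilde: $\tilde{\mathbf{M}}_l,\tilde{\mathbf{P}}_l,\tilde{\mathbf{N}}$, of size $\tilde N\tilde M\times\tilde N\tilde M$. The transfer operators on one subinterval are $\mathbf{R}\in\mathbb{R}^{\tilde N\tilde M\times NM}$ (restriction) and $\mathbf{S}\in\mathbb{R}^{NM\times\tilde N\tilde M}$ (interpolation). Matrices on the whole time domain. $\mathbf{M}_{[t_0,T]}$ is the $L\times L$ block matrix with diagonal blocks $\mathbf{M}_0,\ldots,\mathbf{M}_{L-1}$, all blocks on the first block subdiagonal equal to $-\mathbf{N}$, and zero blocks elsewhere. $\tilde{\mathbf{P}}_{[t_0,T]}$ is the $L\times L$ block matrix with diagonal blocks $\tilde{\mathbf{P}}_0,\ldots,\tilde{\mathbf{P}}_{L-1}$, first block subdiagonal blocks $-\tilde{\mathbf{N}}$, zero elsewhere. $\hat{\mathbf{P}}_{[t_0,T]}=\mathrm{diag}(\mathbf{P}_0,\ldots,\mathbf{P}_{L-1})$. Write $\mathbf{U}_{[t_0,T]}=(\mathbf{U}_0^{\,\cdot},\ldots,\mathbf{U}_{L-1}^{\,\cdot})^T$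 for the stacked vector of the subinterval vectors $\mathbf{U}_l^{\,\cdot}\in\mathbb{R}^{NM}$; below, iterates always carry an iteration superscript, so $\mathbf{U}_0^k$ (iterate on the first subinterval) is distinct from the initial data $\mathbf{U}_0$. Two-level PFASST (one fine and one coarse sweep per iteration, no prediction phase). Given the iterate $(\mathbf{U}_l^k)_{l=0}^{L-1}$, iteration $k\to k+1$ is: 1. (Coarse level) For $l=0,1,\ldots,L-1$ in this order: restrict $\tilde{\mathbf{U}}_l^k=\mathbf{R}\mathbf{U}_l^k$; compute the FAS correction $\boldsymbol\tau_l^k=\tilde{\mathbf{M}}_l\mathbf{R}\mathbf{U}_l^k-\mathbf{R}\mathbf{M}_l\mathbf{U}_l^k$; perform one coarse SDC sweep $\tilde{\mathbf{U}}_l^{k+\frac12}=\tilde{\mathbf{U}}_l^k+\tilde{\mathbf{P}}_l^{-1}\left(\tilde{\mathbf{c}}_l+\boldsymbol\tau_l^k-\tilde{\mathbf{M}}_l\tilde{\mathbf{U}}_l^k\right)$, where $\tilde{\mathbf{c}}_0=\mathbf{R}\mathbf{U}_0$ and, for $l>0$, $\tilde{\mathbf{c}}_l=\tilde{\mathbf{N}}\tilde{\mathbf{U}}_{l-1}^{k+\frac12}$ (initial value just received from the preceding subinterval). 2. (Return to the fine level) $\mathbf{U}_l^{k+\frac12}=\mathbf{U}_l^k+\mathbf{S}\left(\tilde{\mathbf{U}}_l^{k+\frac12}-\tilde{\mathbf{U}}_l^k\right)$ for all $l$. The initial value on subinterval $l>0$, which is the last-node value of $\mathbf{U}_{l-1}^{k}$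 sent in the previous iteration, is corrected by the interpolated coarse correction, i.e. it becomes the last-node value of $\mathbf{U}_{l-1}^{k+\frac12}$. 3. (Fine sweep, in parallel) For all $l$: $\mathbf{U}_l^{k+1}=\mathbf{U}_l^{k+\frac12}+\mathbf{P}_l^{-1}\left(\mathbf{c}_l-\mathbf{M}_l\mathbf{U}_l^{k+\frac12}\right)$, where $\mathbf{c}_0=\mathbf{U}_0$ and $\mathbf{c}_l=\mathbf{N}\mathbf{U}_{l-1}^{k+\frac12}$ for $l>0$. *)

(* Defs.v *)
From HB Require Import structures.
From mathcomp Require Import all_boot all_order all_algebra.
From mathcomp Require Import all_classical all_reals all_analysis.
From mathcomp Require Export mxtens.

Set Implicit Arguments.
Unset Strict Implicit.
Unset Printing Implicit Defensive.

Import Order.TTheory GRing.Theory Num.Theory.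
Local Open Scope ring_scope.

(* Block matrices and stacked vectors use the index convention of tensmx: the
   outer factor of a Kronecker product is the block index, so that
   1%:M *t B : 'M_(L * m, L * n) is block diagonal with blocks B. *)
Section Blocks.
Variables (R : pzRingType) (L : nat).

Definition block_matrix m n (B : 'I_L -> 'I_L -> 'M[R]_(m, n)) :
    'M[R]_(L * m, L * n) :=
  \matrix_(i, j) B (mxtens_unindex i).1 (mxtens_unindex j).1
                   (mxtens_unindex i).2 (mxtens_unindex j).2.

Definition block_diag n (D : 'I_L -> 'M[R]_n) : 'M[R]_(L * n) :=
  block_matrix (fun l p => if l == p then D l else 0).

Definition block_bidiag n (D : 'I_L -> 'M[R]_n) (E : 'M[R]_n) :
    'M[R]_(L * n) :=
  block_matrix (fun l p => if l == p then D l
                           else if l == p.+1 :> nat then - E else 0).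

Definition stack n (V : 'I_L -> 'cV[R]_n) : 'cV[R]_(L * n) :=
  \col_i V (mxtens_unindex i).1 (mxtens_unindex i).2 0.

Definition unstack n (V : 'cV[R]_(L * n)) (l : 'I_L) : 'cV[R]_n :=
  \col_i V (mxtens_index (l, i)) 0.

End Blocks.

(* T is the linear part of the affine map Phi; at most one T qualifies. *)
Definition is_iteration_matrix (R : pzRingType) n
    (Phi : 'cV[R]_n -> 'cV[R]_n) (T : 'M[R]_n) : Prop :=
  exists b : 'cV[R]_n, forall V : 'cV[R]_n, Phi V = T *m V + b.

(* The sampling points are indexed by 'I_M, whereas x.-lagrange of qpoly needs
   an injective sequence of points indexed by nat. *)
Definition lagrange_poly (R : fieldType) M (x : 'I_M -> R) (j : 'I_M) :
    {poly R} :=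
  \prod_(k < M | k != j) ((x j - x k)^-1 *: ('X - (x k)%:P)).

Section TimeGrid.
Variables (R : realType) (L : nat) (t0 T : R).

Definition step_size : R := (T - t0) / L%:R.

Definition grid_point (l : nat) : R := t0 + l%:R * step_size.

(* One level of the space-time discretization, with N spatial unknowns and M
   nodes per subinterval. Nodes and Q_Delta may depend on the subinterval. *)
Record sdc_level (N M : nat) := SDCLevel {
  sys_mx : 'M[R]_N;
  node : 'I_L -> 'I_M -> R;
  node_lt : forall (l : 'I_L) (i j : 'I_M), (i < j)%N -> node l i < node l j;
  node_ge : forall (l : 'I_L) (i : 'I_M), grid_point l <= node l i;
  node_last : forall (l : 'I_L) (i : 'I_M), i.+1 = M ->
    node l i = grid_point l.+1;
  qdelta : 'I_L -> 'M[R]_M;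
  (* is_trig_mx means lower triangular *)
  qdelta_trig : forall l : 'I_L, is_trig_mx (qdelta l)
}.

Section Level.
Variables (N M : nat) (F : sdc_level N M).

Definition quad_mx (l : 'I_L) : 'M[R]_M :=
  \matrix_(i, j) (step_size^-1 *
    (\int[lebesgue_measure]_(s in `[grid_point l, node F l i]%classic)
       (lagrange_poly (node F l) j).[s])).

Definition colloc_mx (l : 'I_L) : 'M[R]_(M * N) :=
  1%:M - step_size *: (quad_mx l *t sys_mx F).

Definition prec_mx (l : 'I_L) : 'M[R]_(M * N) :=
  1%:M - step_size *: (qdelta F l *t sys_mx F).

Definition sdc_sweep (l : 'I_L) (c V : 'cV[R]_(M * N)) : 'cV[R]_(M * N) :=
  V + invmx (prec_mx l) *m (c - colloc_mx l *m V).

End Level.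
End TimeGrid.

Section NodeTransfer.
Variables (R : realType) (M N : nat).

Definition last_node_mx : 'M[R]_M := \matrix_(i, j) (j.+1 == M)%:R.

Definition transfer_mx : 'M[R]_(M * N) := last_node_mx *t 1%:M.

(* the column dimension 1 * 1 of the Kronecker product is convertible to 1 *)
Definition spread (u0 : 'cV[R]_N) : 'cV[R]_(M * N) :=
  (const_mx 1 : 'cV[R]_M) *t u0.

End NodeTransfer.

Section PFASST.
Variables (R : realType) (L : nat) (t0 T : R) (N M Nc Mc : nat).
Variables (F : sdc_level L t0 T N M) (C : sdc_level L t0 T Nc Mc).
Variables (Rm : 'M[R]_(Mc * Nc, M * N)) (Sm : 'M[R]_(M * N, Mc * Nc)).
Variable (u0 : 'cV[R]_N).

Implicit Types U V : 'I_L -> 'cV[R]_(M * N).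

Definition fas_correction U (l : 'I_L) : 'cV[R]_(Mc * Nc) :=
  colloc_mx C l *m (Rm *m U l) - Rm *m (colloc_mx F l *m U l).

Definition coarse_step U (l : 'I_L) (c : 'cV[R]_(Mc * Nc)) :
    'cV[R]_(Mc * Nc) :=
  sdc_sweep C l (c + fas_correction U l) (Rm *m U l).

Fixpoint coarse_sweeps U (l : nat) : (l < L)%N -> 'cV[R]_(Mc * Nc) :=
  match l return (l < L)%N -> 'cV[R]_(Mc * Nc) with
  | 0 => fun lt_l => coarse_step U (Ordinal lt_l) (Rm *m spread M u0)
  | p.+1 => fun lt_l => coarse_step U (Ordinal lt_l)
              (transfer_mx R Mc Nc *m coarse_sweeps U (ltnW lt_l))
  end.

Definition pfasst_half U : 'I_L -> 'cV[R]_(M * N) := fun l =>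
  U l + Sm *m (coarse_sweeps U (ltn_ord l) - Rm *m U l).

(* ord_pred l has value l - 1 when l > 0 *)
Definition fine_rhs V (l : 'I_L) : 'cV[R]_(M * N) :=
  if l == 0 :> nat then spread M u0
  else transfer_mx R M N *m V (ord_pred l).

Definition pfasst_step U : 'I_L -> 'cV[R]_(M * N) := fun l =>
  sdc_sweep F l (fine_rhs (pfasst_half U) l) (pfasst_half U l).

Definition rhs_global : 'cV[R]_(L * (M * N)) :=
  stack (fun l : 'I_L => if l == 0 :> nat then spread M u0 else 0).

End PFASST.

Section GlobalMatrices.
Variables (R : realType) (L : nat) (t0 T : R) (N M : nat).
Variable F : sdc_level L t0 T N M.

Definition colloc_global : 'M[R]_(L * (M * N)) :=
  block_bidiag (colloc_mx F) (transfer_mx R M N).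

Definition prec_global_seq : 'M[R]_(L * (M * N)) :=
  block_bidiag (prec_mx F) (transfer_mx R M N).

Definition prec_global_par : 'M[R]_(L * (M * N)) :=
  block_diag (prec_mx F).

End GlobalMatrices.

(* Main.v *)
Require Import Defs.
From HB Require Import structures.
From mathcomp Require Import all_boot all_order all_algebra.
From mathcomp Require Import all_classical all_reals all_analysis.
Import Order.TTheory GRing.Theory Num.Theory.
Local Open Scope ring_scope.

(** Why PFASST has this matrix form.  A coarse sweep only ever acts through the
coarse correction [D l], the swept coarse value minus the restricted fine one.
In the sweep the FAS correction cancels the coarse collocation residual and
leaves the restricted fine one, so that
  [Pc l *m D l = c l - Rm *m (M l *m U l)],
where [Pc l] and [M l] are the coarse preconditioner and the fine collocation
matrix.  For [l > 0] the received value is [c l = Ec *m (D (l-1) + Rm *m U (l-1))],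
with [Ec] and [E] the coarse and fine transfers of the last node, and
[Ec *m Rm = Rm *m E] turns [Ec *m (Rm *m U (l-1))] into
[Rm *m (E *m U (l-1))].  Moving [Ec *m D (l-1)] to the left-hand side gives
exactly block row [l] of
  [Pt *m stack D = TFC *m (c - MM *m stack U)],
so the sequential loop over the subintervals is forward substitution for the
block bidiagonal matrix [Pt] ([prec_mul_coarse_correction]).  That matrix is
invertible because its diagonal blocks are ([block_bidiag_unit]).  The fine
sweep is block diagonal once the received initial values are read as the
subdiagonal blocks of [MM] ([fine_residual_stack]).  The iteration matrix is
then the product of the linear parts of these two affine maps. *)

(** * Action of block matrices on stacked vectors *)

Section Blocks.
Context {R : pzRingType} {L : nat}.

Lemma unstackK n (V : 'cV[R]_(L * n)) : stack (unstack V) = V.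
Proof. by apply/colP => i; rewrite !mxE -surjective_pairing mxtens_unindexK. Qed.

Lemma stackK n (V : 'I_L -> 'cV[R]_n) l : unstack (stack V) l = V l.
Proof. by apply/colP => i; rewrite !mxE mxtens_indexK. Qed.

Lemma eq_stack n (V W : 'I_L -> 'cV[R]_n) : V =1 W -> stack V = stack W.
Proof. by move=> eqVW; apply/colP => i; rewrite !mxE eqVW. Qed.

Lemma stackD n (V W : 'I_L -> 'cV[R]_n) :
  stack V + stack W = stack (fun l => V l + W l).
Proof. by apply/colP => i; rewrite !mxE. Qed.

Lemma stackB n (V W : 'I_L -> 'cV[R]_n) :
  stack V - stack W = stack (fun l => V l - W l).
Proof. by apply/colP => i; rewrite !mxE. Qed.

Lemma block_matrix_stack m n (B : 'I_L -> 'I_L -> 'M[R]_(m, n))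
    (V : 'I_L -> 'cV[R]_n) :
  block_matrix B *m stack V = stack (fun l => \sum_p B l p *m V p).
Proof.
apply/colP => i; rewrite !mxE summxE.
under [RHS]eq_bigr do rewrite mxE.
rewrite pair_big /=.
rewrite (reindex (@mxtens_index L n)) /=; last first.
  exists (@mxtens_unindex L n) => j _; [exact: mxtens_indexK|exact: mxtens_unindexK].
by apply: eq_bigr => -[p j] _ /=; rewrite !mxE mxtens_indexK.
Qed.

Lemma block_diag_stack n (D : 'I_L -> 'M[R]_n) (V : 'I_L -> 'cV[R]_n) :
  block_diag D *m stack V = stack (fun l => D l *m V l).
Proof.
rewrite block_matrix_stack; apply: eq_stack => l.
rewrite (bigD1 l) //= eqxx big1 ?addr0 // => p pl.
by rewrite eq_sym (negbTE pl) mul0mx.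
Qed.

Lemma ord_pred_val (l : 'I_L) p : l = p.+1 :> nat -> ord_pred l = p :> nat.
Proof.
move=> lp; rewrite /= lp addSn /= modnDr modn_small //.
by apply: ltnW; rewrite -lp.
Qed.

(** [ord_pred] wraps around, so the first block row, which has no subdiagonal
block, has to be singled out. *)
Lemma block_bidiag_stack n (D : 'I_L -> 'M[R]_n) (E : 'M[R]_n)
    (V : 'I_L -> 'cV[R]_n) :
  block_bidiag D E *m stack V =
  stack (fun l => D l *m V l -
    if l == 0 :> nat then 0 else E *m V (ord_pred l)).
Proof.
rewrite block_matrix_stack; apply: eq_stack => l.
rewrite (bigD1 l) //= eqxx; congr (_ + _).
case: (posnP l) => [l0 | l_gt0].
  rewrite big1 ?oppr0 // => p pl.
  by rewrite eq_sym (negbTE pl) l0 mul0mx.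
have lE : l = (ord_pred l).+1 :> nat.
  by rewrite (@ord_pred_val l l.-1) ?prednK.
have pl : ord_pred l != l.
  by apply/eqP => /(congr1 val) /= plE; move: lE; rewrite /= plE => /n_Sn.
rewrite (bigD1 (ord_pred l)) //= eq_sym (negbTE pl) {1}lE eqxx mulNmx.
rewrite big1 ?addr0 // => p /andP[p_l p_pl].
rewrite eq_sym (negbTE p_l) lE eqSS eq_sym val_eqE (negbTE p_pl).
by rewrite mul0mx.
Qed.

End Blocks.

Lemma tens1mx_stack {R : comPzRingType} L m n (B : 'M[R]_(m, n))
    (V : 'I_L -> 'cV[R]_n) :
  (1%:M *t B) *m stack V = stack (fun l => B *m V l).
Proof.
have -> : 1%:M *t B = block_matrix (fun l p : 'I_L => if l == p then B else 0).
  apply/matrixP => i j; rewrite !mxE.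
  by case: eqP; rewrite /= ?mul1r ?mul0r ?mxE.
rewrite block_matrix_stack; apply: eq_stack => l.
rewrite (bigD1 l) //= eqxx big1 ?addr0 // => p pl.
by rewrite eq_sym (negbTE pl) mul0mx.
Qed.

(** * Invertibility *)

Lemma mulmx_inj0_unit {K : fieldType} n (A : 'M[K]_n) :
  (forall v : 'cV_n, A *m v = 0 -> v = 0) -> A \in unitmx.
Proof.
move=> Ainj; rewrite -unitmx_tr -row_free_unit; apply: inj_row_free => v vA0.
apply: trmx_inj; rewrite trmx0; apply: Ainj.
by rewrite -[A]trmxK -trmx_mul vA0 trmx0.
Qed.

(** Forward substitution: in the kernel, block [l] vanishes as soon as block
[l - 1] does. *)
Lemma block_bidiag_unit {K : fieldType} L n (D : 'I_L -> 'M[K]_n)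
    (E : 'M[K]_n) :
  (forall l, D l \in unitmx) -> block_bidiag D E \in unitmx.
Proof.
move=> Du; apply: mulmx_inj0_unit => v.
rewrite -[v]unstackK block_bidiag_stack => Dv0.
have v0 (l : 'I_L) : (if l == 0 :> nat then 0 else E *m unstack v (ord_pred l)) = 0 ->
    unstack v l = 0.
  move=> El0; apply: (can_inj (mulKmx (Du l))).
  have := congr1 (fun w => unstack w l) Dv0.
  by rewrite stackK El0 subr0 mulmx0 => ->; apply/colP => i; rewrite !mxE.
have {}v0 k : forall l : 'I_L, l = k :> nat -> unstack v l = 0.
  elim: k => [|k IHk] l lk; apply: v0; rewrite lk //=.
  by rewrite (IHk (ord_pred l)) ?mulmx0 // (ord_pred_val l k).
by apply/colP => i; rewrite mxE (v0 _ _ erefl) !mxE.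
Qed.

Lemma block_diag_unit {K : fieldType} L n (D : 'I_L -> 'M[K]_n) :
  (forall l, D l \in unitmx) -> block_diag D \in unitmx.
Proof.
move=> Du; suff -> : block_diag D = block_bidiag D 0 by exact: block_bidiag_unit.
by apply/matrixP => i j; rewrite !mxE; case: eqP; rewrite // oppr0 if_same.
Qed.

Lemma invmx_block_diag_stack {K : fieldType} L n (D : 'I_L -> 'M[K]_n)
    (V : 'I_L -> 'cV[K]_n) :
  (forall l, D l \in unitmx) ->
  invmx (block_diag D) *m stack V = stack (fun l => invmx (D l) *m V l).
Proof.
move=> Du; apply: (can_inj (mulKmx (block_diag_unit _ _ _ Du))).
rewrite mulKVmx ?block_diag_unit // block_diag_stack.
by apply: eq_stack => l; rewrite mulKVmx.
Qed.

(** * The two levels of one PFASST iteration *)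

Section Iteration.
Context {R : realType} {L N M Nc Mc : nat} {t0 T : R}.
Context (F : sdc_level L t0 T N M) (C : sdc_level L t0 T Nc Mc).
Context (Rm : 'M[R]_(Mc * Nc, M * N)) (Sm : 'M[R]_(M * N, Mc * Nc)).
Context (u0 : 'cV[R]_N).

Lemma coarse_sweepsE (U : 'I_L -> 'cV[R]_(M * N)) (l : 'I_L) :
  coarse_sweeps F C Rm u0 U (ltn_ord l) =
  coarse_step F C Rm U l
    (if l == 0 :> nat then Rm *m spread M u0
     else transfer_mx R Mc Nc *m
            coarse_sweeps F C Rm u0 U (ltn_ord (ord_pred l))).
Proof.
have sweeps_irr p q (lt_p : (p < L)%N) (lt_q : (q < L)%N) : p = q ->
    coarse_sweeps F C Rm u0 U lt_p = coarse_sweeps F C Rm u0 U lt_q.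
  by move=> pq; subst q; rewrite (bool_irrelevance lt_p lt_q).
case: l => -[|p] lt_l; rewrite [LHS]/=.
  by congr (coarse_step _ _ _ _ _ _); exact: val_inj.
congr (coarse_step _ _ _ _ _ _); first exact: val_inj.
by congr (_ *m _); apply: sweeps_irr; rewrite (ord_pred_val _ p).
Qed.

Definition coarse_correction (U : 'I_L -> 'cV[R]_(M * N)) (l : 'I_L) :=
  coarse_sweeps F C Rm u0 U (ltn_ord l) - Rm *m U l.

(** The FAS term cancels the coarse residual: what the coarse preconditioner
sees is the restricted fine residual. *)
Lemma prec_mul_coarse_step (U : 'I_L -> 'cV[R]_(M * N)) l c :
  prec_mx C l \in unitmx ->
  prec_mx C l *m (coarse_step F C Rm U l c - Rm *m U l) =
  c - Rm *m (colloc_mx F l *m U l).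
Proof.
move=> Pu; rewrite /coarse_step /sdc_sweep addrAC subrr add0r mulKVmx //.
by rewrite /fas_correction -addrA [X in _ + X]addrAC subrr sub0r.
Qed.

Lemma fine_residual_stack (U : 'I_L -> 'cV[R]_(M * N)) :
  rhs_global L M u0 - colloc_global F *m stack U =
  stack (fun l => fine_rhs u0 U l - colloc_mx F l *m U l).
Proof.
rewrite block_bidiag_stack stackB; apply: eq_stack => l.
by rewrite /fine_rhs; case: ifP => _; rewrite ?subr0 // sub0r opprB.
Qed.

Lemma prec_mul_coarse_correction (U : 'I_L -> 'cV[R]_(M * N)) :
  (forall l, prec_mx C l \in unitmx) ->
  transfer_mx R Mc Nc *m Rm = Rm *m transfer_mx R M N ->
  prec_global_seq C *m stack (coarse_correction U) =
  (1%:M *t Rm) *m (rhs_global L M u0 - colloc_global F *m stack U).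
Proof.
move=> Pu NR; rewrite fine_residual_stack tens1mx_stack block_bidiag_stack.
apply: eq_stack => l.
rewrite {1}/coarse_correction coarse_sweepsE prec_mul_coarse_step // [RHS]mulmxBr.
rewrite [LHS]addrAC; congr (_ - _); rewrite /fine_rhs.
case: ifP => _; first exact: subr0.
(* the only place where the transfer of initial values must commute with
   restriction *)
by rewrite /coarse_correction mulmxBr subKr !mulmxA NR.
Qed.

Lemma pfasst_half_stack (U : 'I_L -> 'cV[R]_(M * N)) :
  (forall l, prec_mx C l \in unitmx) ->
  transfer_mx R Mc Nc *m Rm = Rm *m transfer_mx R M N ->
  stack (pfasst_half F C Rm Sm u0 U) =
  stack U + (1%:M *t Sm) *m invmx (prec_global_seq C) *m (1%:M *t Rm) *m
    (rhs_global L M u0 - colloc_global F *m stack U).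
Proof.
move=> Pu NR; rewrite -mulmxA -prec_mul_coarse_correction // -mulmxA mulKmx.
  by rewrite tens1mx_stack stackD.
exact: block_bidiag_unit.
Qed.

Lemma pfasst_step_stack (U : 'I_L -> 'cV[R]_(M * N)) :
  (forall l, prec_mx F l \in unitmx) ->
  let V := pfasst_half F C Rm Sm u0 U in
  stack (pfasst_step F C Rm Sm u0 U) =
  stack V + invmx (prec_global_par F) *m
    (rhs_global L M u0 - colloc_global F *m stack V).
Proof.
by move=> Pu V; rewrite fine_residual_stack invmx_block_diag_stack // stackD.
Qed.

End Iteration.

(** * Composition of two preconditioned Richardson steps *)

(** A step [v + B *m (c - A *m v)] has linear part [1 - B *m A] and constant
part [B *m c]; composing two of them multiplies the linear parts. *)
Lemma richardson_comp_iteration_matrix {R : pzRingType} n (A B1 B2 : 'M[R]_n)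
    (c : 'cV[R]_n) (Phi : 'cV[R]_n -> 'cV[R]_n) :
  (forall v, let w := v + B1 *m (c - A *m v) in
     Phi v = w + B2 *m (c - A *m w)) ->
  is_iteration_matrix Phi ((1%:M - B2 *m A) *m (1%:M - B1 *m A)).
Proof.
have stepE B v : v + B *m (c - A *m v) = (1%:M - B *m A) *m v + B *m c.
  by rewrite mulmxBr mulmxBl mul1mx -mulmxA addrCA addrC -addrA addrC addrAC.
move=> PhiE; exists ((1%:M - B2 *m A) *m (B1 *m c) + B2 *m c) => v.
by rewrite PhiE /= !stepE mulmxDr !mulmxA addrA.
Qed.

Theorem theorem1 (R : realType) (L N M Nc Mc : nat) (t0 T : R)
  (L_gt0 : (0 < L)%N) (N_gt0 : (0 < N)%N) (M_gt0 : (0 < M)%N)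
  (Nc_gt0 : (0 < Nc)%N) (Mc_gt0 : (0 < Mc)%N) (t0_lt_T : t0 < T)
  (F : sdc_level L t0 T N M) (C : sdc_level L t0 T Nc Mc)
  (Rm : 'M[R]_(Mc * Nc, M * N)) (Sm : 'M[R]_(M * N, Mc * Nc))
  (u0 : 'cV[R]_N)
  (prec_fine_unit : forall l : 'I_L, prec_mx F l \in unitmx)
  (prec_coarse_unit : forall l : 'I_L, prec_mx C l \in unitmx)
  (transfer_restrict :
     transfer_mx R Mc Nc *m Rm = Rm *m transfer_mx R M N) :
  let TFC : 'M[R]_(L * (Mc * Nc), L * (M * N)) := 1%:M *t Rm in
  let TCF : 'M[R]_(L * (M * N), L * (Mc * Nc)) := 1%:M *t Sm in
  let MM := colloc_global F in
  let Pt := prec_global_seq C in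
  let Ph := prec_global_par F in
  let c := rhs_global L M u0 in
  let half := pfasst_half F C Rm Sm u0 in
  let step := pfasst_step F C Rm Sm u0 in
  [/\ Pt \in unitmx /\ Ph \in unitmx,
      forall U : 'I_L -> 'cV[R]_(M * N),
        stack (half U) =
          stack U + TCF *m invmx Pt *m TFC *m (c - MM *m stack U),
      forall U : 'I_L -> 'cV[R]_(M * N),
        stack (step U) =
          stack (half U) + invmx Ph *m (c - MM *m stack (half U))
    & is_iteration_matrix (fun V => stack (step (unstack V)))
        ((1%:M - invmx Ph *m MM) *m
         (1%:M - TCF *m invmx Pt *m TFC *m MM))].

Proof.
move=> TFC TCF MM Pt Ph c half step.
have halfE U := pfasst_half_stack F C Rm Sm u0 U prec_coarse_unit transfer_restrict.
have stepE U := pfasst_step_stack F C Rm Sm u0 U prec_fine_unit.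
split; [|exact: halfE|exact: stepE|].
  by split; [exact: block_bidiag_unit|exact: block_diag_unit].
apply: (@richardson_comp_iteration_matrix _ _ _ _ _ c) => V /=.
by rewrite stepE halfE unstackK.
Qed.
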